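(* Let $f:\mathbb{R}^n\to\mathbb{R}$ be a non-negative, non-decreasing, convex, continuous and differentiable function with $\nabla f(x)\ge\nabla f(x')$ coordinatewise whenever $x\ge x'$ coordinatewise. Let $A=(a_{ij})\in\mathbb{R}_{\ge0}^{m\times n}$ have rows arriving online, each with at most $d$ non-zero entries, and let $\rho$ be an upper bound on $\frac{\max_t a_{tj}}{\min_{t:a_{tj}>0}a_{tj}}$ for all $1\le j\le n$. For online maximization of (D) when decreasing dual variables is not allowed, the adjusted algorithm (defined in the context; all variables $x,y,\mu$ are monotonically non-decreasing in time) with the parameter $\delta=1/c$ chosen optimally obtains the competitive ratio, in the sense Dual/Primal, $$\max_{c>0}\left[\min_{z}\left(\frac{\min_{\ell=1}^n\left\{\frac{\nabla_\ell f(z)}{\nabla_\ell f(cz)}\right\}}{2\ln(1+\rho d)}\right)-\max_z\left(\frac{z^{\top}\nabla f(z)-f(z)}{f(cz)}\right)\right].$$ That is, for every $c>0$, running the adjusted algorithm with $\delta=1/c$, the final (feasible) primal and dual solutions $\overline{x}$, $(\overline{y},\overline{\mu})$ satisfy that $\sum_{i=1}^m\overline{y}_i-f^\star(\overline{\mu})$ is at least the bracketed quantity times $f(\overline{x})$.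
   Context: Primal program (P): $\min\{f(x): Ax\ge \mathbf 1,\ x\ge 0\}$. Dual program (D): $\max\{\sum_{i=1}^m y_i-f^\star(\mu): y^{\top}A\le\mu^{\top},\ y\ge 0\}$, where $f^\star(\mu)=\sup_z\{\mu^{\top}z-f(z)\}$ is the Fenchel dual of $f$. ''Primal'' is the objective of (P), ''Dual'' the objective of (D). $\nabla_\ell f(z)$ is the $\ell$-th coordinate of $\nabla f(z)$. Row $t$ of $A$ (together with the variable $y_t$) is revealed at round $t$. In the ratio, $z$ ranges over $\mathbb{R}^n_{\ge0}$ (min/max understood as inf/sup, over points where the quotients are defined). Adjusted algorithm with parameter $\delta>0$. Initially $x=0$, $y=0$. At round $t$, while $\sum_{j=1}^n a_{tj}x_j<1$, increase a continuous time variable $\tau$ at rate $1$, and simultaneously: for each $j$ with $a_{tj}>0$, increase $x_j$ at rate $\dfrac{\partial x_j}{\partial\tau}=\dfrac{a_{tj}x_j+\frac1d}{\nabla_j f(x)}$; maintain $\mu=\nabla f(\delta x)$; and increase $y_t$ at rate $r=\dfrac{1}{\ln(1+d\rho)}\cdot\min_{\ell=1}^n\left\{\dfrac{\nabla_\ell f(\delta x)}{\nabla_\ell f(x)}\right\}$. No dual variable is ever decreased. All rates are taken to be well defined along the execution.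
   Formalization: The formal theorem adds the hypothesis f(0) = 0; without it the claim is false (e.g. n=m=d=ρ=1, c=1.2, A=(1/c), f(0)=1/2, f'(x)=min(1,ε+x) for x≥0, f(x)=½e^{2εx} for x<0: Dual≈0.53 but ratio·Primal≈0.72). *)

(* Defs.v *)
From HB Require Import structures.
From mathcomp Require Import all_boot all_order all_algebra.
From mathcomp Require Import all_classical all_reals all_analysis.
Set Implicit Arguments.
Unset Strict Implicit.
Unset Printing Implicit Defensive.
Import Order.TTheory GRing.Theory Num.Theory.
Import numFieldNormedType.Exports.
Local Open Scope classical_set_scope.
Local Open Scope ring_scope.

(* Vectors of R^n with n >= 1 are row vectors 'rV[R]_n.+1, so that minima over
   the coordinates range over a nonempty set. *)

Definition vle (R : realType) (n : nat) (u v : 'rV[R]_n) : Prop :=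
  forall j, u 0 j <= v 0 j.

Definition dot (R : realType) (n : nat) (u v : 'rV[R]_n) : R :=
  \sum_j u 0 j * v 0 j.

Definition gradient (R : realType) (n : nat) (f : 'rV[R]_n -> R)
    (z : 'rV[R]_n) : 'rV[R]_n :=
  \row_l 'D_(delta_mx 0 l) f z.

Definition fenchel (R : realType) (n : nat) (f : 'rV[R]_n -> R)
    (mu : 'rV[R]_n) : \bar R :=
  ereal_sup [set (dot mu z - f z)%:E | z in [set: 'rV[R]_n]].

Definition primal_feasible (R : realType) (m n : nat) (A : 'M[R]_(m, n))
    (x : 'rV[R]_n) : Prop :=
  vle 0 x /\ forall t, 1 <= dot (row t A) x.

Definition dual_feasible (R : realType) (m n : nat) (A : 'M[R]_(m, n))
    (y : 'rV[R]_m) (mu : 'rV[R]_n) : Prop :=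
  vle 0 y /\ vle (y *m A) mu.

Definition dual_objective (R : realType) (m n : nat) (f : 'rV[R]_n -> R)
    (y : 'rV[R]_m) (mu : 'rV[R]_n) : \bar R :=
  ((\sum_i y 0 i)%:E - fenchel f mu)%E.

Definition colmax (R : realType) (m n : nat) (A : 'M[R]_(m, n)) (j : 'I_n) : R :=
  \big[Order.max/0]_t A t j.

(* The entries being nonnegative, the default value colmax A j of the minimum
   only matters for a zero column. *)
Definition colmin_pos (R : realType) (m n : nat) (A : 'M[R]_(m, n))
    (j : 'I_n) : R :=
  \big[Order.min/colmax A j]_(t | 0 < A t j) A t j.

Definition bounds_column_ratios (R : realType) (m n : nat) (A : 'M[R]_(m, n))
    (rho : R) : Prop :=
  forall j, (exists t, 0 < A t j) -> colmax A j / colmin_pos A j <= rho.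

(* min_l grad_l f(z) / grad_l f(w) *)
Definition min_grad_ratio (R : realType) (n : nat) (f : 'rV[R]_n.+1 -> R)
    (z w : 'rV[R]_n.+1) : R :=
  let q l := gradient f z 0 l / gradient f w 0 l in
  \big[Order.min/q ord0]_l q l.

(* The infimum and the supremum below range over the nonnegative points at which
   no denominator vanishes (division by 0 being total in the library). *)
Definition inf_grad_ratio (R : realType) (n : nat) (f : 'rV[R]_n.+1 -> R)
    (d : nat) (rho c : R) : \bar R :=
  ereal_inf [set (min_grad_ratio f z (c *: z) / (2 * ln (1 + rho * d%:R)))%:E
    | z in [set z | vle 0 z /\ forall l, gradient f (c *: z) 0 l != 0]].

Definition sup_fenchel_ratio (R : realType) (n : nat) (f : 'rV[R]_n -> R)
    (c : R) : \bar R :=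
  ereal_sup [set ((dot z (gradient f z) - f z) / f (c *: z))%:E
    | z in [set z | vle 0 z /\ f (c *: z) != 0]].

Definition competitive_ratio (R : realType) (n : nat) (f : 'rV[R]_n.+1 -> R)
    (d : nat) (rho c : R) : \bar R :=
  (inf_grad_ratio f d rho c - sup_fenchel_ratio f c)%E.

Definition best_competitive_ratio (R : realType) (n : nat)
    (f : 'rV[R]_n.+1 -> R) (d : nat) (rho : R) : \bar R :=
  ereal_sup [set competitive_ratio f d rho c | c in [set c : R | 0 < c]].

Definition x_rate (R : realType) (m n : nat) (f : 'rV[R]_n.+1 -> R)
    (A : 'M[R]_(m, n.+1)) (d : nat) (t : 'I_m) (j : 'I_n.+1)
    (x : 'rV[R]_n.+1) : R :=
  if 0 < A t j then (A t j * x 0 j + d%:R^-1) / gradient f x 0 j else 0.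

Definition y_rate (R : realType) (n : nat) (f : 'rV[R]_n.+1 -> R) (d : nat)
    (rho delta : R) (x : 'rV[R]_n.+1) : R :=
  (ln (1 + d%:R * rho))^-1 * min_grad_ratio f (delta *: x) x.

(* [x], [y], [mu] are the values of the variables as functions of tau.  Rounds
   are numbered from 0: round t occupies the time interval [T t, T t.+1], which
   is a single point when the constraint t is already satisfied on arrival.  The
   differential equations are required in the interior of each round, and the
   variables are continuous on [0, T m]; this allows executions whose rates
   blow up or are undefined at the starting point x = 0 only.
   [ex_defined] says that the rates are well defined: where f is nondecreasing
   its gradient is nonnegative, so "nonzero" means "positive". *)
Record execution (R : realType) (m n : nat) (f : 'rV[R]_n.+1 -> R)
    (A : 'M[R]_(m, n.+1)) (d : nat) (rho delta : R) (T : nat -> R)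
    (x : R -> 'rV[R]_n.+1) (y : R -> 'rV[R]_m) (mu : R -> 'rV[R]_n.+1) : Prop :=
  Execution {
    ex_T0 : T 0%N = 0;
    ex_Tle : forall t : 'I_m, T t <= T t.+1;
    ex_x0 : x 0 = 0;
    ex_y0 : y 0 = 0;
    ex_xcont : {within `[0, T m], continuous x};
    ex_ycont : {within `[0, T m], continuous y};
    ex_mu : forall s, 0 <= s <= T m -> mu s = gradient f (delta *: x s);
    ex_loop : forall (t : 'I_m) s, T t <= s < T t.+1 -> dot (row t A) (x s) < 1;
    ex_exit : forall t : 'I_m, 1 <= dot (row t A) (x (T t.+1));
    ex_defined : forall (t : 'I_m) s, T t < s < T t.+1 ->
      forall l, 0 < gradient f (x s) 0 l;
    ex_dx : forall (t : 'I_m) s, T t < s < T t.+1 ->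
      forall j, is_derive s 1 (fun u => x u 0 j) (x_rate f A d t j (x s));
    ex_dy : forall (t : 'I_m) s, T t < s < T t.+1 ->
      forall i, is_derive s 1 (fun u => y u 0 i)
        (if i == t then y_rate f d rho delta (x s) else 0)
  }.

Definition nondecreasing_until (R : realType) (n : nat) (Tend : R)
    (v : R -> 'rV[R]_n) : Prop :=
  forall s s', 0 <= s -> s <= s' -> s' <= Tend -> vle (v s) (v s').

(* Main.v *)
(** Everything follows from the monotonicity in time of potentials that start
    at 0.
    - Dual feasibility for column j, with a = colmax A j and L = ln (1 + d rho):
      G ln (1 + d a x_j) - L (y A)_j is nondecreasing, where G is the final
      value of mu_j.  At the end x_j is at most rho / a, since x_j only grows in
      a round t with A t j > 0, which stops once A t j x_j reaches 1.
    - Dual against primal: f(x) grows at rate at most (row t A) x + 1 <= 2, and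
      the sum of y at rate at least 2 r, where r is the infimum in the
      competitive ratio; hence r f(x) is at most the sum of y.  The supremum
      accounts for the conjugate, which by convexity equals
      z . grad f(z) - f(z) at mu = grad f(z), z = x / c. *)
Require Import Defs.
From HB Require Import structures.
From mathcomp Require Import all_boot all_order all_algebra.
From mathcomp Require Import all_classical all_reals all_analysis.
From mathcomp Require Import ring lra.
Set Implicit Arguments.
Unset Strict Implicit.
Unset Printing Implicit Defensive.
Import Order.TTheory GRing.Theory Num.Theory.
Import numFieldNormedType.Exports.
Local Open Scope classical_set_scope.
Local Open Scope ring_scope.

(** * Gradients and convexity *)

Lemma derive_dot_gradient (R : realType) (n : nat) (f : 'rV[R]_n -> R)
    (w v : 'rV[R]_n) :
  differentiable f w -> 'D_v f w = dot v (gradient f w).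
Proof.
move=> df; rewrite deriveE// {1}(row_sum_delta v) linear_sum /dot.
apply: eq_bigr => j _.
by rewrite linearZ/= mxE deriveE.
Qed.

Section ConvexFunctions.
Context {R : realType} {n : nat} (f : 'rV[R]_n -> R).
Hypothesis f_diff : forall z, differentiable f z.

(** One-sided quotients suffice: convexity bounds them for positive steps [h] up to 1, and
    monotonicity on the nonnegative orthant only allows moving forward. *)
Lemma cvg_right_derive (w v : 'rV[R]_n) :
  h^-1 * (f (h *: v + w) - f w) @[h --> 0^'+] --> ('D_v f w : R).
Proof.
apply: cvg_dnbhs_at_right.
have : derivable f w v by exact: diff_derivable.
exact.
Qed.

(** By convexity every difference quotient from [w] towards [z] with step at most 1 is below
    [f z - f w], hence so is the limit. *)
Lemma convex_gradient_le (w z : 'rV[R]_n) :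
  convex_function [set: 'rV[R]_n] f ->
  dot (z - w) (gradient f w) <= f z - f w.
Proof.
move=> cf; rewrite -derive_dot_gradient//.
apply: (cvgr_to_le (@cvg_right_derive w (z - w))).
near=> h.
have h0 : 0 < h by [].
have h01 : 0 <= h <= 1.
  by rewrite ltW//=; near: h; exact: nbhs_right_le.
have := cf (Itv01 (andP h01).1 (andP h01).2) z w.
rewrite !inE => /(_ Logic.I Logic.I); rewrite convRE/=.
have -> : conv (Itv01 (andP h01).1 (andP h01).2) (z : convex_lmodType _) w
    = h *: (z - w) + w.
  rewrite /conv/= scalerBr -addrA; congr (_ + _).
  by rewrite /unstable.onem scalerBl scale1r addrC.
rewrite /unstable.onem => hle.
rewrite -[leRHS]mul1r -(@mulVf _ h) ?gt_eqF// -mulrA.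
rewrite ler_wpM2l ?invr_ge0 ?(ltW h0)//.
lra.
Unshelve. all: by end_near. Qed.

Lemma gradient_ge0 (z : 'rV[R]_n) l :
  (forall z z' : 'rV[R]_n, vle 0 z -> vle z z' -> f z <= f z') ->
  vle 0 z -> 0 <= gradient f z 0 l.
Proof.
move=> fmono z0; rewrite mxE.
apply: (cvgr_to_ge (@cvg_right_derive z (delta_mx 0 l))).
near=> h.
have h0 : 0 < h by [].
rewrite mulr_ge0 ?invr_ge0 ?(ltW h0)// subr_ge0; apply: fmono => // j.
by rewrite !mxE lerDr mulr_ge0// ltW.
Unshelve. all: by end_near. Qed.

(** Equality case of the Fenchel-Young inequality: by the tangent inequality the supremum is
    attained at [w]. *)
Lemma fenchel_gradient (w : 'rV[R]_n) :
  convex_function [set: 'rV[R]_n] f ->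
  fenchel f (gradient f w) = (dot w (gradient f w) - f w)%:E.
Proof.
move=> cf; apply/le_anti/andP; split.
  apply: ge_ereal_sup => _ [z _ <-]; rewrite lee_fin.
  have := convex_gradient_le w z cf.
  have -> : dot (z - w) (gradient f w)
      = dot (gradient f w) z - dot w (gradient f w).
    by rewrite /dot -sumrB; apply: eq_bigr => j _; rewrite !mxE; ring.
  lra.
apply: ereal_sup_ubound; exists w => //; congr (_ - _)%:E.
by apply: eq_bigr => j _; rewrite mulrC.
Qed.

End ConvexFunctions.

(** * Derivatives along a trajectory *)

Lemma is_derive_comp_gradient (R : realType) (n : nat) (f : 'rV[R]_n -> R)
    (x : R -> 'rV[R]_n) (s : R) (dx : 'rV[R]_n) :
  differentiable f (x s) ->
  (forall j, is_derive s 1 (fun u => x u 0 j) (dx 0 j)) ->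
  is_derive s 1 (fun u => f (x u)) (dot dx (gradient f (x s))).
Proof.
move=> df xs.
have dx1 : derivable x s 1.
  by apply/derivable_mxP => i j; rewrite ord1; exact: ex_derive.
have dxs : differentiable x s by exact/derivable1_diffP.
have dfx : differentiable (f \o x) s by exact: differentiable_comp.
split; first exact/derivable1_diffP.
change ('D_1 (f \o x) s = dot dx (gradient f (x s))).
rewrite deriveE// diff_comp//= -[X in _ X = _]deriveE// -deriveE//.
rewrite derive_dot_gradient//; congr dot; apply/rowP => j.
by rewrite derive_mx// mxE (@derive_val _ _ _ _ _ _ _ (xs j)).
Qed.

Lemma ge0_derive_nondecreasing (R : realType) (phi dphi : R -> R) (a b : R) :
  {within `[a, b], continuous phi} ->
  (forall s, a < s < b -> is_derive s 1 phi (dphi s)) ->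
  (forall s, a < s < b -> 0 <= dphi s) ->
  forall s s', a <= s -> s <= s' -> s' <= b -> phi s <= phi s'.
Proof.
move=> cphi dp dp0 s s' as_ ss s'b.
apply: (@ger0_derive1_le_cc _ phi a b) => //; rewrite ?in_itv/=.
- by move=> u; rewrite in_itv/= => /dp u_; exact: ex_derive.
- move=> u; rewrite in_itv/= => uab; rewrite derive1E.
  by rewrite (@derive_val _ _ _ _ _ _ _ (dp _ uab)) dp0.
- by rewrite as_ (le_trans ss).
- by rewrite s'b (le_trans as_).
Qed.

(** * Monotonicity across consecutive rounds *)

Section Rounds.
Context {R : realType} {m : nat} (T : nat -> R).
Hypothesis T0 : T 0%N = 0.
Hypothesis Tle : forall t : 'I_m, T t <= T t.+1.

Lemma rounds_le (k l : nat) : (k <= l <= m)%N -> T k <= T l.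
Proof.
elim: l => [|l IH]; first by rewrite leqn0 andbC => /andP[_ /eqP->].
rewrite leq_eqVlt => /andP[/orP[/eqP->//|kl] lm].
apply: (le_trans (IH _)); first by rewrite -ltnS kl ltnW.
exact: (Tle (Ordinal lm)).
Qed.

Lemma rounds_ge0 (k : nat) : (k <= m)%N -> 0 <= T k.
Proof. by move=> km; rewrite -T0 rounds_le. Qed.

(** The induction on rounds also yields [0 <= phi (T t)], which the argument inside round [t] may
    use: the rate of a coordinate of [x] is shown nonnegative from that sign. *)
Lemma rounds_nondecreasing (phi : R -> R) :
  0 <= phi 0 ->
  (forall t : 'I_m, 0 <= phi (T t) ->
    forall s s', T t <= s -> s <= s' -> s' <= T t.+1 -> phi s <= phi s') ->
  forall s s', 0 <= s -> s <= s' -> s' <= T m -> phi s <= phi s'.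
Proof.
move=> phi0 phiT.
suff main k : (k <= m)%N ->
    forall s s', 0 <= s -> s <= s' -> s' <= T k -> phi s <= phi s'.
  exact: main.
elim: k => [_ s s' s0 ss|k IH km s s' s0 ss s'k].
  rewrite T0 => s'0.
  by have -> : s = s' by apply/le_anti; rewrite ss (le_trans s'0).
have Tk0 : 0 <= T k by rewrite rounds_ge0// ltnW.
have phik : 0 <= phi (T k).
  by apply: (le_trans phi0); apply: (IH (ltnW km)).
have step := phiT (Ordinal km) phik.
have [s'Tk|/ltW Tks'] := leP s' (T k); first exact: (IH (ltnW km)).
have [sTk|/ltW Tks] := leP s (T k); last exact: step.
apply: (@le_trans _ _ (phi (T k))); first by apply: (IH (ltnW km)).
exact: step.
Qed.

End Rounds.

Lemma is_derive_affine (R : realType) (phi : R -> R) (s p k e : R) :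
  is_derive s 1 phi p -> is_derive s 1 (fun u => k * phi u + e) (k * p).
Proof.
move=> dp.
have -> : (fun u => k * phi u + e) = (k \*: phi) + cst e by [].
by apply: is_derive_eq; rewrite addr0.
Qed.

Lemma rounds_derive_nondecreasing (R : realType) (m : nat) (T : nat -> R)
    (phi : R -> R) (dphi : 'I_m -> R -> R) :
  T 0%N = 0 -> (forall t : 'I_m, T t <= T t.+1) ->
  {within `[0, T m], continuous phi} -> 0 <= phi 0 ->
  (forall (t : 'I_m) s, T t < s < T t.+1 -> is_derive s 1 phi (dphi t s)) ->
  (forall (t : 'I_m) s, T t < s < T t.+1 -> 0 <= dphi t s) ->
  forall s s', 0 <= s -> s <= s' -> s' <= T m -> phi s <= phi s'.
Proof.
move=> T0 Tle cphi phi0 dp dp0; apply: rounds_nondecreasing => // t _.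
apply: (@ge0_derive_nondecreasing _ phi (dphi t)); [|exact: dp0].
apply: continuous_subspaceW cphi => s; rewrite /= !in_itv/= => /andP[Ts sT].
have tm : (t < m)%N by [].
rewrite (le_trans _ Ts)/= ?(@rounds_ge0 _ m)// 1?ltnW//.
by rewrite (le_trans sT)// (@rounds_le _ m)// tm /=.
Qed.

(* Along the flow w = k phi + e satisfies w' = k w / g, so w^2 cannot decrease
   and w never reaches 0. *)
Lemma affine_growth_ge0 (R : realType) (phi g : R -> R) (a b k e : R) :
  {within `[a, b], continuous phi} -> 0 < e -> 0 <= k -> 0 <= phi a ->
  (forall s, a < s < b -> 0 < g s) ->
  (forall s, a < s < b -> is_derive s 1 phi ((k * phi s + e) / g s)) ->
  forall s, a <= s <= b -> 0 <= k * phi s + e.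
Proof.
move=> cphi e0 k0 phia g0 dp s /andP[as_ sb].
pose w u := k * phi u + e.
have dw u : a < u < b -> is_derive u 1 w (k * (w u / g u)).
  by move=> /dp; exact: is_derive_affine.
have cw : {within `[a, b], continuous w}.
  move=> u; apply: cvgD; last exact: cvg_cst.
  by apply: cvgM; [exact: cvg_cst|exact: cphi].
have cw2 : {within `[a, b], continuous (w * w)}.
  by move=> u; apply: cvgM; exact: cw.
have w2 u : a <= u -> u <= b -> (w * w) a <= (w * w) u.
  move=> au ub.
  apply: (@ge0_derive_nondecreasing _ (w * w)
    (fun u => w u *: (k * (w u / g u)) + w u *: (k * (w u / g u))) a b) => //.
    by move=> v vab; apply: is_deriveM; exact: dw.
  move=> v vab; rewrite /GRing.scale/=.
  have -> : w v * (k * (w v / g v)) = k * (w v ^+ 2 / g v).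
    by rewrite expr2; ring.
  by rewrite addr_ge0// mulr_ge0// divr_ge0 ?sqr_ge0// ltW// g0.
have wa : 0 < w a by rewrite /w ltr_wpDl// mulr_ge0.
rewrite leNgt; apply/negP => ws.
have [] := @IVT _ w a s 0 as_.
- by apply: continuous_subspaceW cw; apply: subset_itvl; rewrite bnd_simp.
- by rewrite ge_min le_max (ltW wa) (ltW ws) orbT.
move=> v; rewrite in_itv/= => /andP[av vs] wv.
have := w2 v av (le_trans vs sb).
by rewrite /= {2}/GRing.mul/= wv mul0r leNgt mulr_gt0.
Qed.

(** * Weighted sums and compositions along vector-valued paths *)

Lemma continuous_weighted_sum (R : realType) (k : nat) (w : 'I_k -> R) :
  continuous (fun v : 'rV[R]_k => \sum_i v 0 i * w i).
Proof.
have -> : (fun v : 'rV[R]_k => \sum_i v 0 i * w i)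
    = \sum_i (fun v : 'rV[R]_k => v 0 i * w i).
  by apply/funext => v; rewrite fct_sumE.
move=> v; elim/big_ind : _ => [|g h cg ch|i _].
  by change (continuous_at v (fun=> 0 : R)); exact: cst_continuous.
  exact: (@continuousD _ _ _ g h).
apply: (@continuousM _ _ (fun v : 'rV[R]_k => v 0 i) (fun=> w i)).
  exact: coord_continuous.
exact: cst_continuous.
Qed.

Lemma is_derive_weighted_sum (R : realType) (k : nat) (v : R -> 'rV[R]_k)
    (dv w : 'I_k -> R) (s : R) :
  (forall i, is_derive s 1 (fun u => v u 0 i) (dv i)) ->
  is_derive s 1 (fun u => \sum_i v u 0 i * w i) (\sum_i dv i * w i).
Proof.
move=> dvs.
have -> : (fun u => \sum_i v u 0 i * w i) = \sum_i (fun u => v u 0 i * w i).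
  by apply/funext => u; rewrite fct_sumE.
apply: is_derive_sum => i.
have -> : (fun u => v u 0 i * w i) = (fun u => w i * v u 0 i + 0).
  by apply/funext => u; rewrite addr0 mulrC.
by rewrite [dv i * _]mulrC; exact: is_derive_affine.
Qed.

Lemma within_continuous_comp_continuous (U V W : topologicalType) (D : set U)
    (v : U -> V) (g : V -> W) :
  continuous g -> {within D, continuous v} ->
  {within D, continuous (fun s => g (v s))}.
Proof. by move=> cg; apply: within_continuous_comp => u _; exact: cg. Qed.

(** * Column extrema and gradient ratios *)

Section Columns.
Context {R : realType} {m n : nat} (A : 'M[R]_(m, n)).

Lemma le_colmax t j : A t j <= colmax A j.
Proof. exact: (@le_bigmax _ _ _ _ (fun t => A t j) t). Qed.

Lemma colmax_eq0 j : (forall t, A t j = 0) -> colmax A j = 0.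
Proof.
by move=> A0; apply/big1_idem => [|t _]; [exact: maxxx|exact: A0].
Qed.

Lemma colmin_pos_gt0 t j : 0 < A t j -> 0 < colmin_pos A j.
Proof.
(* The default value [colmax A j] must be positive too; it dominates [A t j]. *)
by move=> A0; apply: lt_bigmin => //; exact: lt_le_trans (le_colmax t j).
Qed.

Lemma colmin_pos_le t j : 0 < A t j -> colmin_pos A j <= A t j.
Proof.
exact: (@bigmin_le_cond _ _ _ _ t (fun t => 0 < A t j) (fun t => A t j)).
Qed.

End Columns.

Section MinGradRatio.
Context {R : realType} {n : nat} (f : 'rV[R]_n.+1 -> R) (z w : 'rV[R]_n.+1).

Lemma min_grad_ratio_le l :
  min_grad_ratio f z w <= gradient f z 0 l / gradient f w 0 l.
Proof. exact: (@bigmin_le _ _ _ _ l). Qed.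

Lemma min_grad_ratio_ge0 :
  (forall l, 0 <= gradient f z 0 l) -> (forall l, 0 <= gradient f w 0 l) ->
  0 <= min_grad_ratio f z w.
Proof. by move=> z0 w0; apply: le_bigmin => [|l _]; rewrite divr_ge0. Qed.

End MinGradRatio.

(** * Executions: monotone variables and primal feasibility *)

Section Execution.
Context {R : realType} {m n : nat} (f : 'rV[R]_n.+1 -> R)
  (A : 'M[R]_(m, n.+1)) (d : nat) (rho delta : R) (T : nat -> R)
  (x : R -> 'rV[R]_n.+1) (y : R -> 'rV[R]_m) (mu : R -> 'rV[R]_n.+1).
Hypothesis E : execution f A d rho delta T x y mu.
Hypothesis f_nondecr : forall z z', vle 0 z -> vle z z' -> f z <= f z'.
Hypothesis f_convex : convex_function [set: 'rV[R]_n.+1] f.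
Hypothesis f_diff : forall z, differentiable f z.
Hypothesis f_grad : forall z z', vle z z' -> vle (gradient f z) (gradient f z').
Hypothesis A_ge0 : forall t j, 0 <= A t j.
Hypothesis d_gt0 : (0 < d)%N.
Hypothesis A_rho : bounds_column_ratios A rho.
Hypothesis delta_ge0 : 0 <= delta.

Let T0 := ex_T0 E.
Let Tle := ex_Tle E.

Lemma round_subset (t : 'I_m) s : T t <= s <= T t.+1 -> 0 <= s <= T m.
Proof.
move=> /andP[Ts sT]; have tm : (t < m)%N by [].
rewrite (le_trans _ Ts)/= ?(@rounds_ge0 _ m)// 1?ltnW//.
by rewrite (le_trans sT)// (@rounds_le _ m)// tm /=.
Qed.

Lemma continuous_within_round (t : 'I_m) (phi : R -> R) :
  {within `[0, T m], continuous phi} ->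
  {within `[T t, T t.+1], continuous phi}.
Proof.
by apply: continuous_subspaceW => s; rewrite /= !in_itv/=; exact: round_subset.
Qed.

Lemma continuous_coord_x j : {within `[0, T m], continuous (fun s => x s 0 j)}.
Proof.
exact: (within_continuous_comp_continuous
  (@coord_continuous _ _ _ 0 j) (ex_xcont E)).
Qed.

(** Breaks a circularity: a coordinate grows because its rate is nonnegative, which seems to need
    the coordinate nonnegative throughout the round. The growth law derives this from the sign at
    the start of the round. *)
Lemma x_rate_numerator_ge0 (t : 'I_m) j s : 0 <= x (T t) 0 j ->
  T t <= s <= T t.+1 -> 0 < A t j -> 0 <= A t j * x s 0 j + d%:R^-1.
Proof.
move=> x0 sT A0.
apply: (@affine_growth_ge0 _ (fun s => x s 0 j)
  (fun s => gradient f (x s) 0 j) (T t) (T t.+1)) => //.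
- exact/continuous_within_round/continuous_coord_x.
- by rewrite invr_gt0 ltr0n.
- by move=> u uT; exact: (ex_defined E uT).
- by move=> u uT; have := ex_dx E uT j; rewrite /x_rate A0.
Qed.

Lemma x_coord_le j s s' :
  0 <= s -> s <= s' -> s' <= T m -> x s 0 j <= x s' 0 j.
Proof.
move: s s'; apply: (rounds_nondecreasing T0 Tle).
  by rewrite (ex_x0 E) mxE.
move=> t x0.
apply: (@ge0_derive_nondecreasing _ (fun s => x s 0 j)
  (fun s => x_rate f A d t j (x s))).
- exact/continuous_within_round/continuous_coord_x.
- by move=> s sT; exact: (ex_dx E sT j).
- move=> s sT; rewrite /x_rate; case: ifP => // A0.
  apply: divr_ge0; last exact/ltW/(ex_defined E sT).
  by apply: x_rate_numerator_ge0 => //; case/andP: sT => /ltW-> /ltW->.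
Qed.

Lemma x_nondecreasing : nondecreasing_until (T m) x.
Proof. by move=> s s' s0 ss sT j; exact: x_coord_le. Qed.

Lemma x_ge0 s : 0 <= s <= T m -> vle 0 (x s).
Proof. by move=> /andP[s0 sT]; rewrite -(ex_x0 E); exact: x_nondecreasing. Qed.

Lemma delta_x_ge0 s : 0 <= s <= T m -> vle 0 (delta *: x s).
Proof.
move=> /x_ge0 x0 j; rewrite !mxE mulr_ge0//.
by have := x0 j; rewrite mxE.
Qed.

Lemma Tm_ge0 : 0 <= T m. Proof. exact: (rounds_ge0 T0 Tle). Qed.

Lemma mu_nondecreasing : nondecreasing_until (T m) mu.
Proof.
move=> s s' s0 ss sT.
rewrite !(ex_mu E) ?s0 ?sT ?(le_trans s0 ss) ?(le_trans ss sT)//.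
by apply: f_grad => j; rewrite !mxE ler_wpM2l// x_nondecreasing.
Qed.

(** A zero row would have product 0 with [x], against the exit condition. *)
Lemma row_has_pos (t : 'I_m) : exists j, 0 < A t j.
Proof.
apply/existsP; apply/contraT => /existsPn A0.
have := ex_exit E t.
rewrite /dot big1 ?ler10// => j _; rewrite mxE.
by have := A0 j; rewrite lt_neqAle A_ge0 andbT negbK => /eqP <-; rewrite mul0r.
Qed.

(** A column with a positive entry has ratio at least 1. The round [t] supplies such a column; with
    no rows [A_rho] says nothing about [rho]. *)
Lemma rho_ge1 (t : 'I_m) : 1 <= rho.
Proof.
have [j A0] := row_has_pos t.
apply: le_trans (A_rho (ex_intro _ t A0)).
rewrite ler_pdivlMr ?mul1r ?(colmin_pos_gt0 A0)//.
exact: le_trans (colmin_pos_le A0) (le_colmax _ _ _).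
Qed.

Lemma lnrho_gt0 (t : 'I_m) : 0 < ln (1 + d%:R * rho).
Proof.
by rewrite ln_gt0// ltrDl mulr_gt0 ?ltr0n// (lt_le_trans ltr01)// (rho_ge1 t).
Qed.

Lemma y_rate_ge0 (t : 'I_m) s :
  0 <= s <= T m -> 0 <= y_rate f d rho delta (x s).
Proof.
move=> sT; rewrite mulr_ge0 ?invr_ge0 ?(ltW (lnrho_gt0 t))//.
apply: min_grad_ratio_ge0 => l; apply: gradient_ge0 => //.
  exact: delta_x_ge0.
exact: x_ge0.
Qed.

Lemma y_coord_le i s s' :
  0 <= s -> s <= s' -> s' <= T m -> y s 0 i <= y s' 0 i.
Proof.
move: s s'.
apply: (@rounds_derive_nondecreasing _ m T (fun s => y s 0 i)
  (fun t s => if i == t then y_rate f d rho delta (x s) else 0)) => //.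
- exact: (within_continuous_comp_continuous
    (@coord_continuous _ _ _ 0 i) (ex_ycont E)).
- by rewrite (ex_y0 E) mxE.
- by move=> t s sT; exact: (ex_dy E sT i).
- move=> t s /andP[/ltW sT /ltW Ts]; case: ifP => // _.
  by apply: (y_rate_ge0 t); apply: (@round_subset t); rewrite sT.
Qed.

Lemma y_nondecreasing : nondecreasing_until (T m) y.
Proof. by move=> s s' s0 ss sT j; exact: y_coord_le. Qed.

Lemma x_primal_feasible : primal_feasible A (x (T m)).
Proof.
split; first by apply: x_ge0; rewrite Tm_ge0/=.
move=> t; apply: (le_trans (ex_exit E t)).
apply: ler_sum => j _; rewrite mxE ler_wpM2l// x_coord_le//.
  exact: (rounds_ge0 T0 Tle).
by apply: (rounds_le Tle); rewrite leqnn andbT.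
Qed.

(** * Column bounds and dual feasibility *)

(** Continuity carries the loop condition to the endpoint. In a round of zero length the constraint
    may already hold with slack on arrival. *)
Lemma row_dot_end_le1 (t : 'I_m) :
  T t < T t.+1 -> dot (row t A) (x (T t.+1)) <= 1.
Proof.
move=> TT; rewrite leNgt; apply/negP => x1.
pose h s := \sum_j x s 0 j * row t A 0 j.
have hE s : dot (row t A) (x s) = h s by apply: eq_bigr => j _; rewrite mulrC.
have ch : {within `[T t, T t.+1], continuous h}.
  apply: continuous_within_round.
  exact: (within_continuous_comp_continuous
    (@continuous_weighted_sum _ _ (fun j => row t A 0 j))
    (ex_xcont E)).
have h0 : h (T t) < 1 by rewrite -hE (ex_loop E)// lexx.
rewrite hE in x1.
(* The value halfway between 1 and the supposed larger end value would be taken before the end,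
   where the loop condition forbids it. *)
have [] := @IVT _ h (T t) (T t.+1) ((1 + h (T t.+1)) / 2) (ltW TT) ch.
  by rewrite ge_min le_max; apply/andP; split; apply/orP; [left|right]; lra.
move=> s; rewrite in_itv/= => /andP[ts sT] hs.
have sT' : s < T t.+1.
  by rewrite lt_neqAle sT andbT; apply/eqP => sE; rewrite sE in hs; lra.
have : h s < 1 by rewrite -hE (ex_loop E)// ts.
lra.
Qed.

Lemma x_const_round (t : 'I_m) j : A t j = 0 -> x (T t.+1) 0 j <= x (T t) 0 j.
Proof.
move=> A0; rewrite -lerN2.
apply: (@ge0_derive_nondecreasing _ (fun s => - x s 0 j) (fun=> 0)
  (T t) (T t.+1)) => //.
- apply: continuous_within_round => s; apply: cvgN; exact: continuous_coord_x.
- move=> s sT; have := ex_dx E sT j; rewrite /x_rate A0 ltxx => dx.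
  by apply: (is_derive_eq (is_deriveN dx)); rewrite oppr0.
Qed.

Lemma colmax_x_le (t0 : 'I_m) j : colmax A j * x (T m) 0 j <= rho.
Proof.
have rho0 : 0 <= rho by exact: le_trans (rho_ge1 t0).
have [[t At]|A0] := pselect (exists t, 0 < A t j); last first.
  rewrite colmax_eq0 ?mul0r// => t; apply/le_anti/andP; split => //.
  by rewrite leNgt; apply/negP => At; apply: A0; exists t.
have cmax0 : 0 < colmax A j by exact: lt_le_trans At (le_colmax _ _ _).
suff main k : (k <= m)%N -> colmax A j * x (T k) 0 j <= rho by exact: main.
elim: k => [_|k IH km]; first by rewrite T0 (ex_x0 E) mxE mulr0.
pose t' := Ordinal km.
have {}IH := IH (ltnW km).
have [TT|Tlt] := leP (T k.+1) (T k).
  suff -> : T k.+1 = T k by [].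
  by apply/le_anti; rewrite TT (Tle t').
(* A round not involving column [j] does not raise [x_j], so the induction hypothesis persists;
   otherwise the bound is obtained afresh at the end of this round. *)
have [Ak0|Ak0] := eqVneq (A t' j) 0.
  apply: le_trans IH; rewrite ler_wpM2l ?(ltW cmax0)//.
  exact: x_const_round Ak0.
have Ak : 0 < A t' j by rewrite lt_neqAle eq_sym Ak0 A_ge0.
apply: le_trans (A_rho (ex_intro _ t' Ak)).
rewrite ler_wpM2l ?(ltW cmax0)// -div1r ler_pdivlMr ?(colmin_pos_gt0 Ak)//.
have xT : 0 <= T k.+1 <= T m.
  by apply: (@round_subset t'); rewrite (Tle t') lexx.
have x0 i : 0 <= x (T k.+1) 0 i by have := x_ge0 xT i; rewrite mxE.
apply: (@le_trans _ _ (x (T k.+1) 0 j * A t' j)).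
  by rewrite ler_wpM2l// colmin_pos_le.
(* [A t' j * x_j] is one nonnegative term of a sum that is at most 1. *)
apply: le_trans (@row_dot_end_le1 t' Tlt).
rewrite /dot (bigD1 j)//= mxE mulrC lerDl sumr_ge0// => i _.
by rewrite mxE mulr_ge0.
Qed.


Lemma is_derive_ln_affine (p k s : R) (phi : R -> R) :
  0 < k * phi s + 1 -> is_derive s 1 phi p ->
  is_derive s 1 (fun u => ln (k * phi u + 1)) ((k * phi s + 1)^-1 * (k * p)).
Proof.
move=> k0 dp; apply: (@is_derive1_comp _ (@ln R) (fun u => k * phi u + 1)).
  exact: is_derive1_ln.
exact: is_derive_affine.
Qed.

Lemma y_mul_A_le_mu j : (y (T m) *m A) 0 j <= mu (T m) 0 j.
Proof.
have Tm : 0 <= T m <= T m by rewrite Tm_ge0/=.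
have mu0 : 0 <= mu (T m) 0 j.
  by rewrite (ex_mu E)//; apply: gradient_ge0 => //; exact: delta_x_ge0.
(* Without rounds [y *m A] is an empty sum and [mu0] suffices. *)
have [/existsP[t0 _]|/existsPn m0] := boolP [exists t : 'I_m, true]; last first.
  by rewrite mxE big1// => i; have := m0 i.
(* Freezing [mu] at its final value keeps the coefficient constant in time. *)
set G := mu (T m) 0 j in mu0 *.
pose L := ln (1 + d%:R * rho).
have L0 : 0 < L by exact: lnrho_gt0 t0.
pose D := d%:R * colmax A j.
have cmax0 : 0 <= colmax A j by exact: le_trans (A_ge0 t0 j) (le_colmax _ _ _).
have D0 : 0 <= D by rewrite mulr_ge0.
have xs0 s : 0 <= s <= T m -> 0 <= x s 0 j.
  by move=> /x_ge0 /(_ j); rewrite mxE.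
have pos s : 0 <= s <= T m -> 0 < D * x s 0 j + 1.
  by move=> /xs0 ?; rewrite ltr_wpDl// mulr_ge0.
(* The terms [+ 0] give both summands the shape of [is_derive_affine]. *)
pose phi s := G * ln (D * x s 0 j + 1) + 0 + (- L * \sum_i y s 0 i * A i j + 0).
have phiE s : phi s = G * ln (D * x s 0 j + 1) - L * (y s *m A) 0 j.
  by rewrite /phi !addr0 mulNr mxE.
pose dphi (t : 'I_m) s :=
  G * ((D * x s 0 j + 1)^-1 * (D * x_rate f A d t j (x s)))
  + - L * \sum_i (if i == t then y_rate f d rho delta (x s) else 0) * A i j.
have : phi 0 <= phi (T m).
  apply: (@rounds_derive_nondecreasing _ m T phi dphi T0 Tle _ _ _ _ 0 (T m))
    => //; rewrite ?Tm_ge0//.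
  - have cln : {within `[0, T m], continuous (fun s => ln (D * x s 0 j + 1))}.
      apply: (@within_continuous_comp _ _ _ _
        (fun s => D * x s 0 j + 1) (@ln R)).
        move=> u; rewrite inE => -[s /=]; rewrite in_itv => /pos ? <-.
        exact: continuous_ln.
      move=> s; apply: cvgD; last exact: cvg_cst.
      by apply: cvgM; [exact: cvg_cst|exact: continuous_coord_x].
    have cy := within_continuous_comp_continuous
      (@continuous_weighted_sum _ _ (fun i => A i j)) (ex_ycont E).
    move=> s; apply: cvgD; apply: cvgD; try exact: cvg_cst.
      by apply: cvgM; [exact: cvg_cst|exact: cln].
    by apply: cvgM; [exact: cvg_cst|exact: cy].
  - rewrite phiE (ex_x0 E) (ex_y0 E) mul0mx !mxE !mulr0 add0r ln1 mulr0.
    by rewrite subr0.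
  - move=> t s sT.
    have sTm : 0 <= s <= T m.
      by apply: (@round_subset t); case/andP: sT => /ltW-> /ltW->.
    apply: is_deriveD.
      apply: is_derive_affine.
      exact: (is_derive_ln_affine (pos s sTm) (ex_dx E sT j)).
    apply: is_derive_affine; apply: is_derive_weighted_sum => i.
    exact: (ex_dy E sT i).
  - move=> t s sT.
    have sTm : 0 <= s <= T m.
      by apply: (@round_subset t); case/andP: sT => /ltW-> /ltW->.
    have g0 := ex_defined E sT j.
    rewrite /dphi (bigD1 t)//= eqxx big1 ?addr0; last first.
      by move=> i /negbTE->; rewrite mul0r.
    rewrite /x_rate; case: ifPn => [At|]; last first.
      rewrite lt_neqAle A_ge0 andbT negbK => /eqP <-.
      by rewrite !mulr0 addr0.
    rewrite mulNr subr_ge0.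
    set g := gradient f (x s) 0 j in g0 *.
    (* [L] cancels the logarithm in [y_rate], the minimum is at most its term at [j], and the
       gradient at [delta *: x s] is at most [G]. *)
    apply: (@le_trans _ _ (G * (A t j / g))).
      rewrite /y_rate -/L -[_ * _ * A t j]mulrA mulVKf ?gt_eqF//.
      rewrite [leLHS]mulrC [leRHS]mulrCA ler_wpM2l//.
      apply: (le_trans (min_grad_ratio_le _ _ _ j)); rewrite -/g.
      rewrite ler_wpM2r ?invr_ge0 ?(ltW g0)//.
      rewrite /G (ex_mu E)//; apply: f_grad => l; rewrite !mxE ler_wpM2l//.
      by apply: x_coord_le => //; case/andP: sTm.
    (* The scaling [D] of the logarithm is chosen for this: the constant terms agree since
       [D / d = colmax A j] dominates [A t j], and the linear terms coincide. *)
    have num : A t j * (D * x s 0 j + 1) <= D * (A t j * x s 0 j + d%:R^-1).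
      rewrite mulrDr mulr1 mulrCA [leRHS]mulrDr lerD2l /D mulrAC mulfV ?mul1r.
        exact: le_colmax.
      by rewrite pnatr_eq0 -lt0n.
    rewrite ler_wpM2l//.
    have -> : (D * x s 0 j + 1)^-1 * (D * ((A t j * x s 0 j + d%:R^-1) / g))
        = D * (A t j * x s 0 j + d%:R^-1) / (D * x s 0 j + 1) / g by ring.
    by rewrite ler_wpM2r ?invr_ge0 ?(ltW g0)// ler_pdivlMr ?pos.
(* At time [T m], [D * x_j] is at most [d * rho], so the logarithm is at most [L], which then
   cancels. *)
rewrite !phiE (ex_x0 E) (ex_y0 E) mul0mx !mxE !mulr0 add0r ln1 mulr0 subr0.
rewrite subr_ge0 => LS; rewrite -(ler_pM2l L0) (le_trans LS)//.
rewrite mulrC ler_wpM2r// ler_ln ?posrE ?pos//; last first.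
  by rewrite addr_gt0// mulr_gt0 ?ltr0n// (lt_le_trans ltr01 (rho_ge1 t0)).
by rewrite addrC lerD2l /D -mulrA ler_wpM2l// colmax_x_le.
Qed.

(** * Growth of the primal objective against the dual sum *)

Hypothesis f0 : f 0 = 0.
Hypothesis f_ge0 : forall z, vle 0 z -> 0 <= f z.
Hypothesis f_cont : continuous f.
Hypothesis A_sparse : forall t, (#|[pred j | A t j != 0%R]| <= d)%N.

(** The gradient cancels the denominators of [x_rate], leaving a row product below 1 and [1/d] for
    each of at most [d] nonzero entries. *)
Lemma objective_rate_le2 (t : 'I_m) s : T t < s < T t.+1 ->
  dot (\row_j x_rate f A d t j (x s)) (gradient f (x s)) <= 2.
Proof.
move=> sT.
have loop : dot (row t A) (x s) < 1.
  by apply: (ex_loop E); case/andP: sT => /ltW-> ->.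
have sparse : \sum_(j | A t j != 0) (d%:R^-1 : R) <= 1.
  rewrite sumr_const -[leLHS]mulr_natr ler_pdivrMl ?ltr0n// mulr1 ler_nat.
  exact: A_sparse.
apply: (@le_trans _ _ (dot (row t A) (x s) + \sum_(j | A t j != 0) d%:R^-1)).
  rewrite /dot [X in _ + X]big_mkcond/= -big_split/=; apply: ler_sum => j _.
  rewrite [X in X * _ <= _]mxE [X in _ <= X * _ + _]mxE.
  rewrite /x_rate lt_neqAle A_ge0 andbT eq_sym.
  have [->|At] := eqVneq (A t j) 0; first by rewrite !mul0r addr0.
  by rewrite /= divfK// gt_eqF// (ex_defined E sT).
lra.
Qed.

(** The factor 2 in the premise pays for the growth bound 2 of [f (x s)]; the potential starts at 0
    because [f 0 = 0]. *)
Lemma objective_le_dual_sum (r : R) : 0 <= r ->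
  (forall (t : 'I_m) s, T t < s < T t.+1 ->
    2 * r <= y_rate f d rho delta (x s)) ->
  r * f (x (T m)) <= \sum_i y (T m) 0 i.
Proof.
move=> r0 rle.
pose phi s := (- r * f (x s) + 0) + \sum_i y s 0 i * 1.
have phiE s : phi s = \sum_i y s 0 i - r * f (x s).
  rewrite /phi addr0 mulNr addrC; congr (_ - _).
  by apply: eq_bigr => i _; rewrite mulr1.
pose dphi (t : 'I_m) s :=
  - r * dot (\row_j x_rate f A d t j (x s)) (gradient f (x s))
  + \sum_i (if i == t then y_rate f d rho delta (x s) else 0) * 1.
have : phi 0 <= phi (T m).
  apply: (@rounds_derive_nondecreasing _ m T phi dphi T0 Tle _ _ _ _ 0 (T m))
    => //; rewrite ?Tm_ge0//.
  - have cfx := within_continuous_comp_continuous f_cont (ex_xcont E).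
    have cy := within_continuous_comp_continuous
      (@continuous_weighted_sum _ _ (fun=> 1)) (ex_ycont E).
    move=> s; apply: cvgD; last exact: cy.
    apply: cvgD; last exact: cvg_cst.
    by apply: cvgM; [exact: cvg_cst|exact: cfx].
  - rewrite phiE (ex_x0 E) f0 mulr0 subr0 (ex_y0 E) big1// => i _.
    by rewrite mxE.
  - move=> t s sT; apply: is_deriveD.
      apply: is_derive_affine; apply: is_derive_comp_gradient => // j.
      by rewrite mxE; exact: (ex_dx E sT j).
    by apply: is_derive_weighted_sum => i; exact: (ex_dy E sT i).
  - move=> t s sT.
    rewrite /dphi (bigD1 t)//= eqxx big1 ?addr0; last first.
      by move=> i /negbTE->; rewrite mul0r.
    rewrite mulr1 addrC mulNr subr_ge0 (le_trans _ (rle t s sT))//.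
    by rewrite mulrC ler_wpM2r// objective_rate_le2.
rewrite !phiE (ex_x0 E) f0 mulr0 subr0 (ex_y0 E) big1 ?subr_ge0// => i _.
by rewrite mxE.
Qed.

(** The starting point [x = 0] violates the first constraint. This provides interior times, where
    the gradient is known to be positive. *)
Lemma first_round_nonempty (t : 'I_m) : t = 0%N :> nat -> T t < T t.+1.
Proof.
move=> t0; rewrite lt_neqAle (Tle t) andbT; apply/eqP => TT.
have := ex_exit E t; rewrite -TT t0 T0 (ex_x0 E) /dot big1 ?ler10// => j _.
by rewrite !mxE mulr0.
Qed.

(** Makes [f (x (T m))] an admissible denominator. In the tangent inequality at [x s] the linear
    term is nonnegative, and it vanishes only if [x s = x (T m)], impossible while constraint [t] is
    violated. *)
Lemma objective_gt0 (t : 'I_m) s : T t < s < T t.+1 -> 0 < f (x (T m)).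
Proof.
move=> sT; have /andP[Ts sT'] := sT.
have sTm : 0 <= s <= T m by apply: (@round_subset t); rewrite !ltW.
have xs j : x s 0 j <= x (T m) 0 j.
  by case/andP: sTm => s0 sm; exact: x_coord_le.
apply: (@lt_le_trans _ _
  (f (x s) + dot (x (T m) - x s) (gradient f (x s)))); last first.
  by have := convex_gradient_le f_diff (x s) (x (T m)) f_convex; lra.
apply: ltr_wpDl; first exact/f_ge0/x_ge0.
have term_ge0 j : 0 <= (x (T m) - x s) 0 j * gradient f (x s) 0 j.
  rewrite !mxE mulr_ge0 ?subr_ge0//.
  by have := ex_defined E sT j; rewrite mxE => /ltW.
rewrite lt_neqAle sumr_ge0// andbT eq_sym; apply/eqP => /eqP.
rewrite psumr_eq0// => /allP dot0.
have xE : x s = x (T m).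
  apply/rowP => j; have := dot0 j (mem_index_enum _).
  rewrite mulf_eq0 (gt_eqF (ex_defined E sT j)) orbF !mxE subr_eq0 => /eqP.
  exact.
have loop : dot (row t A) (x s) < 1 by apply: (ex_loop E); rewrite (ltW Ts).
have := x_primal_feasible.2 t; rewrite -xE; lra.
Qed.

End Execution.

(** * Assembling the competitive ratio *)

Theorem corollary2p7 (R : realType) (m n : nat) (f : 'rV[R]_n.+1 -> R)
    (A : 'M[R]_(m, n.+1)) (d : nat) (rho : R)
    (f_ge0 : forall z, vle 0 z -> 0 <= f z)
    (f_nondecr : forall z z', vle 0 z -> vle z z' -> f z <= f z')
    (f_convex : convex_function [set: 'rV[R]_n.+1] f)
    (f_cont : continuous f)
    (f_diff : forall z, differentiable f z)
    (f_grad : forall z z', vle z z' -> vle (gradient f z) (gradient f z'))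
    (f0 : f 0 = 0)
    (A_ge0 : forall t j, 0 <= A t j)
    (d_gt0 : (0 < d)%N)
    (A_sparse : forall t, (#|[pred j | A t j != 0%R]| <= d)%N)
    (A_rho : bounds_column_ratios A rho) :
  forall (c : R) (T : nat -> R) (x : R -> 'rV[R]_n.+1) (y : R -> 'rV[R]_m)
      (mu : R -> 'rV[R]_n.+1),
    0 < c -> execution f A d rho c^-1 T x y mu ->
    [/\ nondecreasing_until (T m) x,
        nondecreasing_until (T m) y
      & nondecreasing_until (T m) mu] /\
    [/\ primal_feasible A (x (T m)),
        dual_feasible A (y (T m)) (mu (T m)),
        (competitive_ratio f d rho c * (f (x (T m)))%:E
           <= dual_objective f (y (T m)) (mu (T m)))%E
      & competitive_ratio f d rho c = best_competitive_ratio f d rho ->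
        (best_competitive_ratio f d rho * (f (x (T m)))%:E
           <= dual_objective f (y (T m)) (mu (T m)))%E].
Proof.
move=> c T x y mu c0 E.
have c0' : 0 <= c^-1 by rewrite invr_ge0 ltW.
have Tm : 0 <= T m <= T m by rewrite (Tm_ge0 E)/=.
have y0 : vle 0 (y (T m)).
  rewrite -(ex_y0 E); apply: (y_nondecreasing E) => //.
  by case/andP: Tm.
have ratio_le : (competitive_ratio f d rho c * (f (x (T m)))%:E
    <= dual_objective f (y (T m)) (mu (T m)))%E.
  rewrite /dual_objective (ex_mu E)// fenchel_gradient//.
  set z := c^-1 *: x (T m).
  have z0 : vle 0 z by exact: (delta_x_ge0 E).
  have cz : c *: z = x (T m) by rewrite scalerA mulfV ?scale1r// gt_eqF.
  (* With no constraints [x] stays at 0 and there is no interior time. The left side is 0 even for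
     an infinite ratio, and the conjugate vanishes. *)
  have [m0|m_gt0] := posnP m.
    have xT : x (T m) = 0 by rewrite m0 (ex_T0 E) (ex_x0 E).
    rewrite /z xT scaler0 f0 mule0 subr0 /dot.
    rewrite [X in (_ - X%:E)%E]big1; last first.
      by move=> j _; rewrite mxE mul0r.
    rewrite sube0 lee_fin sumr_ge0// => i _.
    by have := y0 i; rewrite mxE.
  pose t0 := Ordinal m_gt0.
  have TT : T t0 < T t0.+1 by exact: (first_round_nonempty E).
  (* This interior time makes the final objective positive and the infimum finite. *)
  pose s0 := (T t0 + T t0.+1) / 2.
  have s0T : T t0 < s0 < T t0.+1 by rewrite /s0 !midf_lt.
  have fx0 : 0 < f (x (T m)) by exact: (objective_gt0 E _ _ _ _ _ s0T).
  have L0 : 0 < ln (1 + rho * d%:R).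
    by rewrite mulrC; exact: (lnrho_gt0 E _ _ _ t0).
  rewrite /competitive_ratio.
  have inf_ge0 : (0 <= inf_grad_ratio f d rho c)%E.
    apply: le_ereal_inf_tmp => _ [w [w0 _] <-].
    rewrite lee_fin divr_ge0 ?mulr_ge0 ?(ltW L0)//.
    apply: min_grad_ratio_ge0 => l; apply: gradient_ge0 => //.
    by move=> j; have := w0 j; rewrite !mxE => ?; rewrite mulr_ge0// ltW.
  (* The point [c^-1 *: x s] is admissible in the infimum, and its quotient is exactly half of
     [y_rate]. *)
  have inf_le (t : 'I_m) s : T t < s < T t.+1 ->
      (inf_grad_ratio f d rho c <= (y_rate f d rho c^-1 (x s) / 2)%:E)%E.
    move=> sT; apply: ereal_inf_lbound; exists (c^-1 *: x s).
      split.
        apply: (delta_x_ge0 E) => //.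
        by apply: (round_subset E (t := t)); case/andP: sT => /ltW-> /ltW->.
      move=> l; rewrite scalerA mulfV ?gt_eqF// scale1r.
      exact: (ex_defined E sT).
    congr EFin; rewrite scalerA mulfV ?gt_eqF// scale1r /y_rate invfM.
    by rewrite [rho * _]mulrC; ring.
  have inf_fin : inf_grad_ratio f d rho c \is a fin_num.
    by rewrite ge0_fin_numE// (le_lt_trans (inf_le _ _ s0T))// ltry.
  have sup_ge : (((dot z (gradient f z) - f z) / f (x (T m)))%:E
      <= sup_fenchel_ratio f c)%E.
    apply: ereal_sup_ubound; exists z; last by rewrite cz.
    by split; rewrite ?cz ?gt_eqF.
  rewrite -(fineK inf_fin) in inf_ge0 inf_le *.
  set r := fine _ in inf_ge0 inf_le *.
  have rf : r * f (x (T m)) <= \sum_i y (T m) 0 i.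
    apply: (objective_le_dual_sum E) => // t s sT.
    by have := inf_le t s sT; rewrite lee_fin; lra.
  (* The lower bound [sup_ge] excludes the value -oo. At +oo the ratio is -oo, and so is its product
     with the positive objective. *)
  move: sup_ge; case: (sup_fenchel_ratio f c) => [q| |] //=.
    rewrite lee_fin ler_pdivrMr// => qf.
    by rewrite -EFinM -!EFinB lee_fin mulrBl lerB.
  by move=> _; rewrite mulNyr gtr0_sg// mul1e leNye.
split; first split.
- exact: (x_nondecreasing E).
- exact: (y_nondecreasing E).
- exact: (mu_nondecreasing E).
split.
- exact: (x_primal_feasible E).
- by split => // j; exact: (y_mul_A_le_mu E).
- exact: ratio_le.
(* The premise says that [c] attains the supremum. *)
- by move=> <-; exact: ratio_le.
Qed.
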